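(* Let $q$ be a prime power and let $L$ be a line of $\mathrm{PG}(5,q)$ in the $K$-orbit $o_5$. Then the hyperplane-orbit distribution of $L$ is $OD_4(L)=[1,\,2q^2+q,\,0,\,q^3-q^2]$.
   Context: A point $(y_0,\dots,y_5)$ of $\mathrm{PG}(5,q)$ is identified with the nonzero symmetric matrix $\begin{bmatrix} y_0&y_1&y_2\\ y_1&y_3&y_4\\ y_2&y_4&y_5\end{bmatrix}$ up to scalar. $K\cong\mathrm{PGL}(3,q)$ acts by $M\mapsto AMA^T$, $A\in\mathrm{GL}(3,q)$. The orbit $o_5$ is the $K$-orbit of the line $\left\{\begin{bmatrix}x&0&0\\0&y&0\\0&0&0\end{bmatrix}:(x,y)\in\mathrm{PG}(1,q)\right\}$. Hyperplanes correspond to conics of $\mathrm{PG}(2,q)$ (nonzero quadratic forms up to scalar): $\sum_{0\le i\le j\le2}a_{ij}X_iX_j$ corresponds to $a_{00}Y_0+a_{01}Y_1+a_{02}Y_2+a_{11}Y_3+a_{12}Y_4+a_{22}Y_5=0$. $\mathcal H_1,\mathcal H_{2,r},\mathcal H_{2,i},\mathcal H_3$ are the sets of hyperplanes corresponding respectively to double lines (scalar multiples of squares of linear forms), pairs of distinct real lines (products of two non-proportional linear forms over $\mathbb F_q$), pairs of conjugate imaginary lines (scalar multiples of products of two non-proportional linear forms conjugate over $\mathbb F_{q^2}$), and non-singular conics (those with $4a_{00}a_{11}a_{22}+a_{01}a_{02}a_{12}-a_{00}a_{12}^2-a_{11}a_{02}^2-a_{22}a_{01}^2\ne0$). $OD_4(L)=[h_1,h_{2,r},h_{2,i},h_3]$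 lists the numbers of hyperplanes in $\mathcal H_1,\mathcal H_{2,r},\mathcal H_{2,i},\mathcal H_3$ containing $L$. *)

(* Defs.v *)
From HB Require Import structures.
From mathcomp Require Import all_boot all_order all_algebra all_field.
From mathcomp Require Import mpoly.

Set Implicit Arguments.
Unset Strict Implicit.
Unset Printing Implicit Defensive.

Import GRing.Theory.
Local Open Scope ring_scope.

(* A subspace of PG(5,q) is encoded by the set of all vectors of F^6 that
   represent its points, together with the zero vector. *)

(* The position of the (i,j) entry of a symmetric 3 x 3 matrix in the
   coordinates y_0, ..., y_5; also the position of the coefficient a_ij
   (i <= j) of a quadratic form in a_00, a_01, a_02, a_11, a_12, a_22. *)
Definition symidx (i j : 'I_3) : 'I_6 :=
  inord (nth 0%N (nth [::] [:: [:: 0; 1; 2]; [:: 1; 3; 4]; [:: 2; 4; 5]]%N i) j).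

Definition sym_mx (F : finFieldType) (y : 'rV[F]_6) : 'M[F]_3 :=
  \matrix_(i, j) y 0 (symidx i j).

Definition diag_line (F : finFieldType) : {set 'M[F]_3} :=
  [set diag_mx (\row_k [:: x; y; 0]`_k) | x : F, y : F].

Definition in_o5 (F : finFieldType) (L : {set 'rV[F]_6}) : Prop :=
  exists2 A : 'M[F]_3, A \in unitmx &
    [set sym_mx y | y in L] = [set A *m M *m A^T | M in diag_line F].

Definition linform (F : finFieldType) (l : 'rV[F]_3) : {mpoly F[3]} :=
  \sum_(i < 3) l 0 i *: 'X_i.

Definition quadform (F : finFieldType) (a : 'rV[F]_6) : {mpoly F[3]} :=
  \sum_(i < 3) \sum_(j < 3 | (i <= j)%N) a 0 (symidx i j) *: ('X_i * 'X_j).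

Definition proportional (F : finFieldType) (l m : 'rV[F]_3) : bool :=
  [exists c : F, (l == c *: m) || (m == c *: l)].

Definition double_line (F : finFieldType) (a : 'rV[F]_6) : bool :=
  [exists c : F, exists l : 'rV[F]_3, quadform a == c *: linform l ^+ 2].

Definition real_line_pair (F : finFieldType) (a : 'rV[F]_6) : bool :=
  [exists l : 'rV[F]_3, exists m : 'rV[F]_3,
    ~~ proportional l m && (quadform a == linform l * linform m)].

(* Here E, with its embedding iota of F, plays the role of F_{q^2}; the
   conjugation of E over F is the Frobenius map x |-> x ^ q. *)
Definition conj_line (F E : finFieldType) (l : 'rV[E]_3) : 'rV[E]_3 :=
  map_mx (fun x => x ^+ #|F|) l.

Definition imaginary_line_pair (F E : finFieldType) (iota : {rmorphism F -> E})
    (a : 'rV[F]_6) : bool :=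
  [exists c : F, exists l : 'rV[E]_3,
    ~~ proportional l (conj_line F l) &&
    (map_mpoly iota (quadform a) ==
       iota c *: (linform l * linform (conj_line F l)))].

Definition nonsingular_conic (F : finFieldType) (a : 'rV[F]_6) : bool :=
  let a00 := a 0 (symidx 0 0) in
  let a01 := a 0 (symidx 0 1) in
  let a02 := a 0 (symidx 0 2) in
  let a11 := a 0 (symidx 1 1) in
  let a12 := a 0 (symidx 1 2) in
  let a22 := a 0 (symidx 2 2) in
  4 * a00 * a11 * a22 + a01 * a02 * a12
    - a00 * a12 ^+ 2 - a11 * a02 ^+ 2 - a22 * a01 ^+ 2 != 0.

Definition hyperplane (F : finFieldType) (a : 'rV[F]_6) : {set 'rV[F]_6} :=
  [set y : 'rV[F]_6 | \sum_k a 0 k * y 0 k == 0].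

Definition hyperplanes_of (F : finFieldType) (P : pred 'rV[F]_6) :
    {set {set 'rV[F]_6}} :=
  [set hyperplane a | a : 'rV[F]_6 & (a != 0) && P a].

Definition num_through (F : finFieldType) (L : {set 'rV[F]_6})
    (HH : {set {set 'rV[F]_6}}) : nat :=
  #|[set H in HH | L \subset H]|.

Definition OD4 (F E : finFieldType) (iota : {rmorphism F -> E})
    (L : {set 'rV[F]_6}) : seq nat :=
  [:: num_through L (hyperplanes_of (@double_line F));
      num_through L (hyperplanes_of (@real_line_pair F));
      num_through L (hyperplanes_of (imaginary_line_pair iota));
      num_through L (hyperplanes_of (@nonsingular_conic F))].

(* The hypotheses on E in the main statement can always be met. *)
Lemma quadratic_extension_exists (F : finFieldType) :
  exists (E : finFieldType) (_ : {rmorphism F -> E}), #|E| = (#|F| ^ 2)%N.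
Proof.
pose f (x : F) := x ^+ 2 - x.
have [c nroot] : exists c : F, c \notin codom f.
  case: (pickP (fun c => c \notin codom f)) => [c ?|onto]; first by exists c.
  have : injective f.
    have /image_injP inj : #|image f F| == #|F|.
      by apply/eqP/eq_card => x; apply/negbFE/onto.
    by move=> x y; apply: inj.
  by move=> /(_ 0 1); rewrite /f expr0n expr1n !subrr => /(_ erefl)/esym/eqP;
    rewrite oner_eq0.
pose p : {poly F} := 'X^2 - 'X - c%:P.
have szp : size p = 3%N.
  rewrite /p -addrA -opprD size_polyDl size_polyXn // size_polyN.
  by rewrite size_XaddC.
have irrp : irreducible_poly p.
  apply: cubic_irreducible => [|x]; first by rewrite szp.
  apply: contra nroot.
  rewrite rootE /p !hornerE subr_eq0 => /eqP <-.
  exact: codom_f.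
have [L dimL _] := irredp_FAdjoin irrp.
exists (finvect_type L), (in_alg (finvect_type L)).
rewrite szp in dimL; rewrite -[X in (_ ^ X)%N]dimL.
have := card_vspace (T := finvect_type L) fullv => <-.
by apply: eq_card => v; rewrite memvf.
Qed.

(* Main.v *)
Require Import Defs.
From mathcomp Require Import all_boot all_order all_algebra all_field.
From mathcomp Require Import all_solvable mpoly ring zify.
Set Implicit Arguments.
Unset Strict Implicit.
Unset Printing Implicit Defensive.
Import GRing.Theory.
Local Open Scope ring_scope.

(** Let [u], [v], [w] be the columns of the matrix moving the diagonal line to
    [L], and [al], [be], [ga] the dual basis of linear forms. A hyperplane
    contains [L] iff its quadratic form [Q] vanishes at [u] and [v], that is
    iff [Q = a al be + b al ga + c be ga + d ga^2]. The discriminant of [Q] is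
    a nonzero multiple of [a (b c - a d)]. If it vanishes, [Q] is divisible by
    [ga] (when [a = 0]) or equals [(a al + c ga) (be + (b / a) ga)], so [Q] is
    a pair of real lines unless it is a multiple of [ga^2]. A pair of conjugate
    lines through the rational points [u] and [v] would have both lines equal
    to the line joining them. It remains to count quadruples [(a, b, c, d)],
    each hyperplane arising from [q - 1] of them. *)

(** * Coordinates, index bookkeeping and small determinants *)

Lemma sum_ord3 (V : nmodType) (f : 'I_3 -> V) :
  \sum_i f i = f 0 + f 1 + f 2.
Proof.
rewrite !big_ord_recl big_ord0 addr0 addrA.
by congr (_ + f _ + f _); apply/val_inj.
Qed.

Lemma ord3_ind (P : 'I_3 -> Prop) : P 0 -> P 1 -> P 2 -> forall i, P i.
Proof.
by move=> P0 P1 P2 [[|[|[|i]]] // li];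
  [move: P0 | move: P1 | move: P2]; congr P; apply/val_inj.
Qed.

Lemma sum_symidx (V : nmodType) (f : 'I_6 -> V) :
  \sum_k f k = f (symidx 0 0) + f (symidx 0 1) + f (symidx 0 2)
    + f (symidx 1 1) + f (symidx 1 2) + f (symidx 2 2).
Proof.
rewrite !big_ord_recl big_ord0 addr0 !addrA.
by do 5?congr (_ + _); congr f; apply/val_inj; rewrite /symidx /= inordK.
Qed.

Lemma symidx_sym (i j : 'I_3) : symidx i j = symidx j i.
Proof.
by case: i j => [[|[|[|i]]] // li] [[|[|[|j]]] // lj].
Qed.

Lemma row_symidxP (F : finFieldType) (a b : 'rV[F]_6) :
  (forall i j, a 0 (symidx i j) = b 0 (symidx i j)) -> a = b.
Proof.
move=> ab; suff sym k : exists i j, k = symidx i j.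
  by apply/rowP => k; have [i [j ->]] := sym k.
by case: k => [[|[|[|[|[|[|k]]]]]] lk] //;
  [exists 0, 0|exists 0, 1|exists 0, 2|exists 1, 1|exists 1, 2|exists 2, 2];
  apply/val_inj; rewrite /symidx /= inordK.
Qed.

Lemma det_mx2 (R : comPzRingType) (M : 'M[R]_2) :
  \det M = M 0 0 * M 1 1 - M 0 1 * M 1 0.
Proof.
rewrite (expand_det_row _ 0) !big_ord_recl big_ord0 addr0 /cofactor !det_mx11 !mxE.
do ![rewrite (_ : lift _ _ = 0 :> 'I_2); last exact/val_inj
    |rewrite (_ : lift _ _ = 1 :> 'I_2); last exact/val_inj].
by rewrite expr0 expr1 mul1r mulN1r mulrN.
Qed.

Lemma det_mx3 (R : comPzRingType) (M : 'M[R]_3) : \det M =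
  M 0 0 * (M 1 1 * M 2 2 - M 1 2 * M 2 1)
  - M 0 1 * (M 1 0 * M 2 2 - M 1 2 * M 2 0)
  + M 0 2 * (M 1 0 * M 2 1 - M 1 1 * M 2 0).
Proof.
rewrite (expand_det_row _ 0) sum_ord3 /cofactor !det_mx2 !mxE.
do ![rewrite (_ : lift _ _ = 0 :> 'I_3); last exact/val_inj
    |rewrite (_ : lift _ _ = 1 :> 'I_3); last exact/val_inj
    |rewrite (_ : lift _ _ = 2 :> 'I_3); last exact/val_inj].
by rewrite expr0 expr1 sqrrN expr1n !mul1r mulN1r mulrN.
Qed.

(** * Quadratic forms: values, products of linear forms, polarization *)

Section Forms.
Variable F : finFieldType.
Implicit Types (a b : 'rV[F]_6) (l m : 'rV[F]_3) (x y z : 'cV[F]_3).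

Definition qval a x : F := (quadform a).@[fun i => x i 0].

Definition lval l x : F := (l *m x) 0 0.

Lemma lvalE l x : lval l x = l 0 0 * x 0 0 + l 0 1 * x 1 0 + l 0 2 * x 2 0.
Proof. by rewrite /lval mxE sum_ord3. Qed.

Lemma meval_linform l x : (linform l).@[fun i => x i 0] = lval l x.
Proof.
by rewrite /linform sum_ord3 !mevalD !mevalZ !mevalXU lvalE.
Qed.

Lemma quadformE a : quadform a =
  a 0 (symidx 0 0) *: ('X_0 * 'X_0) + a 0 (symidx 0 1) *: ('X_0 * 'X_1)
  + a 0 (symidx 0 2) *: ('X_0 * 'X_2) + a 0 (symidx 1 1) *: ('X_1 * 'X_1)
  + a 0 (symidx 1 2) *: ('X_1 * 'X_2) + a 0 (symidx 2 2) *: ('X_2 * 'X_2).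
Proof.
rewrite /quadform sum_ord3 !(big_mkcond (fun j : 'I_3 => leq _ j)) !sum_ord3 /=.
by rewrite !add0r !addrA.
Qed.

Lemma qvalE a x : qval a x =
  a 0 (symidx 0 0) * (x 0 0 * x 0 0) + a 0 (symidx 0 1) * (x 0 0 * x 1 0)
  + a 0 (symidx 0 2) * (x 0 0 * x 2 0) + a 0 (symidx 1 1) * (x 1 0 * x 1 0)
  + a 0 (symidx 1 2) * (x 1 0 * x 2 0) + a 0 (symidx 2 2) * (x 2 0 * x 2 0).
Proof.
by rewrite /qval quadformE !mevalD !mevalZ !mevalM !mevalXU.
Qed.

Definition linprod l m : 'rV[F]_6 :=
  \row_k [:: l 0 0 * m 0 0; l 0 0 * m 0 1 + l 0 1 * m 0 0;
             l 0 0 * m 0 2 + l 0 2 * m 0 0; l 0 1 * m 0 1;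
             l 0 1 * m 0 2 + l 0 2 * m 0 1; l 0 2 * m 0 2]`_k.

Lemma linprodE l m (i j : 'I_3) : linprod l m 0 (symidx i j) =
  if i == j then l 0 i * m 0 i else l 0 i * m 0 j + l 0 j * m 0 i.
Proof.
wlog ij : i j / (i <= j)%N.
  move=> le_case; case: (leqP i j) => [/le_case //|/ltnW/le_case].
  rewrite symidx_sym => ->; rewrite eq_sym; case: eqP => [-> //|_].
  exact: addrC.
case: i j ij => [[|[|[|i]]] // li] [[|[|[|j]]] // lj] // _;
  rewrite mxE /symidx /= inordK //=.
all: by do ?congr (_ + _); congr (l _ _ * m _ _); apply/val_inj.
Qed.

Lemma quadform_linprod l m : quadform (linprod l m) = linform l * linform m.
Proof.
rewrite quadformE /linform !sum_ord3 !linprodE /=.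
rewrite -!mul_mpolyC ?(rmorphD, rmorphM) /=; ring.
Qed.

Lemma quadformD a b : quadform (a + b) = quadform a + quadform b.
Proof. rewrite !quadformE !mxE -!mul_mpolyC !rmorphD; ring. Qed.

Lemma quadformZ c a : quadform (c *: a) = c *: quadform a.
Proof. rewrite !quadformE !mxE -!mul_mpolyC !rmorphM; ring. Qed.

Lemma qval_linprod l m x : qval (linprod l m) x = lval l x * lval m x.
Proof. by rewrite /qval quadform_linprod mevalM !meval_linform. Qed.

Lemma qvalD a b x : qval (a + b) x = qval a x + qval b x.
Proof. by rewrite /qval quadformD mevalD. Qed.

Lemma qvalZ c a x : qval (c *: a) x = c * qval a x.
Proof. by rewrite /qval quadformZ mevalZ. Qed.

(** The polar form is taken without dividing by 2, so it still yields the mixed coefficients in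
    characteristic 2. *)
Definition polar a x y := qval a (x + y) - qval a x - qval a y.

Lemma qval_comb a x y z r s t : qval a (r *: x + s *: y + t *: z) =
  r ^+ 2 * qval a x + s ^+ 2 * qval a y + t ^+ 2 * qval a z
  + r * s * polar a x y + r * t * polar a x z + s * t * polar a y z.
Proof. rewrite /polar !qvalE !mxE; ring. Qed.

(** The value at a basis vector gives a diagonal coefficient, and the polar form at two basis
    vectors gives a mixed one. Hence a quadratic form is determined by its values over every finite
    field, even the field with two elements. *)
Lemma qval_inj a b : qval a =1 qval b -> a = b.
Proof.
move=> ab; have pol x y : polar a x y = polar b x y by rewrite /polar !ab.
pose e i : 'cV[F]_3 := delta_mx i 0.
have diag c i : qval c (e i) = c 0 (symidx i i).
  rewrite qvalE /e !mxE.
  by elim/ord3_ind: i; rewrite /= ?(mulr0, mulr1, addr0, add0r).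
have off c i j : i != j -> polar c (e i) (e j) = c 0 (symidx i j).
  rewrite /polar !qvalE /e !mxE.
  by elim/ord3_ind: i; elim/ord3_ind: j => //= _;
    rewrite ?(symidx_sym 1 0) ?(symidx_sym 2 0) ?(symidx_sym 2 1); ring.
apply: row_symidxP => i j; have [->|ij] := eqVneq i j; first by rewrite -!diag.
by rewrite -!off.
Qed.

End Forms.

(** * Linear forms tested on a basis, and proportionality *)

Section LinearForms.
Variable F : finFieldType.
Implicit Types (a b : 'rV[F]_6) (l m : 'rV[F]_3) (x y z : 'cV[F]_3).

Lemma lval_col l n (M : 'M[F]_(3, n)) j : lval l (col j M) = (l *m M) 0 j.
Proof. by rewrite /lval !mxE; apply: eq_bigr => i _; rewrite mxE. Qed.

Lemma lvalD l x y : lval l (x + y) = lval l x + lval l y.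
Proof. by rewrite /lval mulmxDr mxE. Qed.

Lemma lval_eqP (A : 'M[F]_3) (l m : 'rV[F]_3) : A \in unitmx ->
  (forall i, lval l (col i A) = lval m (col i A)) -> l = m.
Proof.
move=> uA lm; rewrite -(mulmxK uA l) -(mulmxK uA m); congr (_ *m _).
by apply/rowP => i; rewrite -!lval_col.
Qed.

Lemma lvalZ c l x : lval (c *: l) x = c * lval l x.
Proof. by rewrite /lval -scalemxAl mxE. Qed.

Lemma lvalDl l m x : lval (l + m) x = lval l x + lval m x.
Proof. by rewrite /lval mulmxDl mxE. Qed.

(** Proportionality is the vanishing of all 2 x 2 minors of the values on the basis of columns of
    [A]. If [m] is nonzero at some column, the quotient of the values there is the factor; otherwise
    [m] is zero. *)
Lemma proportionalP (A : 'M[F]_3) (l m : 'rV[F]_3) : A \in unitmx ->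
  reflect (forall i j, lval l (col i A) * lval m (col j A)
                     = lval l (col j A) * lval m (col i A))
          (proportional l m).
Proof.
move=> uA; apply: (iffP existsP) => [[c /orP[]/eqP->] i j|minor].
- by rewrite !lvalZ; ring.
- by rewrite !lvalZ; ring.
case: (pickP (fun i => lval m (col i A) != 0)) => [i mi|m0].
  exists (lval l (col i A) / lval m (col i A)); apply/orP; left; apply/eqP.
  apply: (lval_eqP uA) => j; rewrite lvalZ; apply: (mulIf mi).
  by rewrite minor mulrAC divfK // mulrC.
exists 0; apply/orP; right; rewrite scale0r; apply/eqP.
apply: (lval_eqP uA) => i; move/negbFE/eqP: (m0 i) => ->.
(* The zero form is written as [0 *: 0] so that [lvalZ] evaluates it. *)
by rewrite -(scale0r 0) lvalZ mul0r.
Qed.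

Lemma polar_prod a c l m : (forall x, qval a x = c * (lval l x * lval m x)) ->
  forall x y, polar a x y = c * (lval l x * lval m y + lval l y * lval m x).
Proof. by move=> alm x y; rewrite /polar !alm !lvalD; ring. Qed.

End LinearForms.

(** * Extension of scalars and pairs of conjugate imaginary lines *)

Section ScalarExtension.
Variables (F E : finFieldType) (iota : {rmorphism F -> E}).

(** The additive group of [F] is an elementary abelian p-group, where p is also the characteristic
    of [E]. This is what makes the map sending x to x^q additive on [E]. *)
Lemma pchar_pnat_card : [pchar E]%R.-nat #|F|.
Proof.
have [p p_pr pF] := finPcharP F.
have pE : p \in [pchar E]%R by rewrite (rmorph_pchar iota).
rewrite (eq_pnat _ (pcharf_eq pE)) -cardsT.
by have := abelem_pgroup (fin_ring_pchar_abelem pF); apply.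
Qed.

Lemma map_quadform (a : 'rV[F]_6) :
  map_mpoly iota (quadform a) = quadform (map_mx iota a).
Proof.
by rewrite !quadformE !mxE !rmorphD /= !map_mpolyZ !rmorphM /= !map_mpolyX.
Qed.

Lemma qval_map (a : 'rV[F]_6) (x : 'cV[F]_3) :
  qval (map_mx iota a) (map_mx iota x) = iota (qval a x).
Proof. by rewrite !qvalE !mxE !(rmorphD, rmorphM). Qed.

(** Coordinates of rational points are fixed by the q-th power map, so conjugating the form
    conjugates its value. *)
Lemma lval_conj_line (l : 'rV[E]_3) (x : 'cV[F]_3) :
  lval (conj_line F l) (map_mx iota x) = lval l (map_mx iota x) ^+ #|F|.
Proof.
rewrite !lvalE !exprDn_pchar ?pchar_pnat_card //.
  by rewrite !exprMn !mxE -!rmorphXn /= !expf_card.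
all: exact: pchar_pnat_card.
Qed.

(** At a rational point x the form equals c l(x) l(x)^q, so its vanishing at the first two columns
    forces l, and with it the conjugate of l, to vanish there. Every 2 x 2 minor is then trivial,
    and the two lines coincide. *)
Lemma imaginary_line_pairF (A : 'M[F]_3) (a : 'rV[F]_6) : A \in unitmx ->
  a != 0 -> qval a (col 0 A) = 0 -> qval a (col 1 A) = 0 ->
  imaginary_line_pair iota a = false.
Proof.
move=> uA a0 au av; apply/existsP => -[c /existsP[l /andP[npr /eqP Q]]].
have Qx (x : 'cV[F]_3) : iota (qval a x) =
    iota c * (lval l (map_mx iota x) * lval l (map_mx iota x) ^+ #|F|).
  rewrite -qval_map /qval -map_quadform Q mevalZ mevalM !meval_linform.
  by rewrite lval_conj_line.
(* With c = 0 the form would vanish at all rational points, hence be zero. *)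
have c0 : c != 0.
  apply: contraNneq a0 => c0; apply/eqP/qval_inj => x; apply: (fmorph_inj iota).
  by rewrite Qx c0 rmorph0 mul0r -(scale0r 0) qvalZ mul0r rmorph0.
have root i : qval a (col i A) = 0 -> lval l (map_mx iota (col i A)) = 0.
  move=> ai; apply/eqP; have /eqP := Qx (col i A); rewrite ai rmorph0 eq_sym.
  rewrite !mulf_eq0 fmorph_eq0 (negPf c0) /= expf_eq0.
  by case/orP => // /andP[].
have uA' : map_mx iota A \in unitmx by rewrite map_unitmx.
case/(proportionalP _ _ uA'): npr => i j; rewrite -!map_col !lval_conj_line.
have q0 : #|F| != 0 by rewrite -lt0n; apply/card_gt0P; exists 0.
by elim/ord3_ind: i; elim/ord3_ind: j;
  rewrite ?(root 0 au) ?(root 1 av) ?expr0n ?(negPf q0) ?(mul0r, mulr0) // mulrC.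
Qed.

End ScalarExtension.

(** * Classification of the conics through the points u and v *)

Section FormsThrough.
Variable F : finFieldType.
Implicit Types (a b : 'rV[F]_6) (l m : 'rV[F]_3) (x y z : 'cV[F]_3).
Variable A : 'M[F]_3.
Hypothesis uA : A \in unitmx.

Let u := col 0 A.
Let v := col 1 A.
Let w := col 2 A.
Let al := row 0 (invmx A).
Let be := row 1 (invmx A).
Let ga := row 2 (invmx A).

Lemma lval_dual i j : lval (row i (invmx A)) (col j A) = (i == j)%:R.
Proof. by rewrite lval_col -row_mul mulVmx // !mxE. Qed.

Lemma dual_expand x : x = lval al x *: u + lval be x *: v + lval ga x *: w.
Proof.
rewrite -[LHS](mulKVmx uA); apply/colP => i.
by rewrite !mxE sum_ord3 /lval -!row_mul !mxE ![_ * A _ _]mulrC.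
Qed.

Definition through_form (t : F * F * F * F) : 'rV[F]_6 :=
  let: (a, b, c, d) := t in
  a *: linprod al be + b *: linprod al ga + c *: linprod be ga
    + d *: linprod ga ga.

Lemma qval_through (a b c d : F) x : qval (through_form (a, b, c, d)) x =
  a * (lval al x * lval be x) + b * (lval al x * lval ga x)
  + c * (lval be x * lval ga x) + d * lval ga x ^+ 2.
Proof. by rewrite !qvalD !qvalZ !qval_linprod -expr2. Qed.

Lemma through_formE (a b c d : F) k : through_form (a, b, c, d) 0 k =
  a * linprod al be 0 k + b * linprod al ga 0 k + c * linprod be ga 0 k
  + d * linprod ga ga 0 k.
Proof.
rewrite /through_form; move: (linprod al be) (linprod al ga) => P Q.
by move: (linprod be ga) (linprod ga ga) => R S; rewrite !mxE.
Qed.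

Definition through_coef a := (polar a u v, polar a u w, polar a v w, qval a w).

(** Expanding x in the basis u, v, w, the two square terms carrying Q(u) and Q(v) drop out; the four
    remaining coefficients are [through_coef a]. *)
Lemma through_formP a :
  qval a u = 0 -> qval a v = 0 -> through_form (through_coef a) = a.
Proof.
move=> au av; apply: qval_inj => x.
by rewrite qval_through [in RHS](dual_expand x) qval_comb au av; ring.
Qed.

Lemma through_formK : cancel through_form through_coef.
Proof.
move=> [[[a b] c] d].
rewrite /through_coef /polar !qval_through !lvalD !lval_dual /=.
by congr (_, _, _, _); ring.
Qed.

Lemma qval_through_col0 t : qval (through_form t) u = 0.
Proof. by case: t => [[[a b] c] d]; rewrite qval_through !lval_dual /=; ring. Qed.

Lemma qval_through_col1 t : qval (through_form t) v = 0.
Proof. by case: t => [[[a b] c] d]; rewrite qval_through !lval_dual /=; ring. Qed.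

(** In the coordinates [al], [be], [ga] the discriminant is abc - a^2 d = a(bc - ad); returning to
    the standard coordinates multiplies it by the square of [\det (invmx A)]. *)
Lemma nonsingular_through (a b c d : F) :
  nonsingular_conic (through_form (a, b, c, d)) = (a * (b * c - a * d) != 0).
Proof.
have detB : \det (invmx A) != 0 by rewrite -unitfE -unitmxE unitmx_inv.
rewrite -[a * _ == 0](mulrI_eq0 _ (mulfI (expf_neq0 2 detB))) det_mx3.
rewrite /nonsingular_conic !through_formE !linprodE /= ![row _ _ _ _]mxE.
congr (_ != 0); ring.
Qed.

(** If Q = k l^2 with k nonzero, then l vanishes at u and v, so every polar value involving u or v
    is zero. The zero form is still allowed on both sides here. *)
Lemma double_line_through (a b c d : F) :
  double_line (through_form (a, b, c, d)) =
  [&& a == 0, b == 0 & c == 0].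
Proof.
apply/existsP/and3P => [[k /existsP[l /eqP Q]]|[/eqP-> /eqP-> /eqP->]]; last first.
  exists d; apply/existsP; exists ga.
  by rewrite /= !scale0r !add0r quadformZ quadform_linprod expr2.
have Qx x : qval (through_form (a, b, c, d)) x = k * (lval l x * lval l x).
  by rewrite /qval Q mevalZ rmorphXn /= meval_linform expr2.
have := through_formK (a, b, c, d).
rewrite /through_coef !(polar_prod Qx) => -[<- <- <- _].
have/eqP := qval_through_col1 (a, b, c, d); rewrite Qx !mulf_eq0 orbb.
have/eqP := qval_through_col0 (a, b, c, d); rewrite Qx !mulf_eq0 orbb.
have [_|_] := eqVneq k 0; first by [].
by rewrite !orFb => /eqP-> /eqP->; rewrite !(mul0r, mulr0, addr0) eqxx.
Qed.

Lemma cross_eq0 (x y x' y' : F) :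
  x * x' = 0 -> x * y' + y * x' = 0 -> x * y' = 0 /\ y * x' = 0.
Proof.
by move/eqP; rewrite mulf_eq0 => /orP[]/eqP->;
  rewrite !(mul0r, mulr0) ?add0r ?addr0.
Qed.

(* [x, y, z] and [x', y', z'] stand for the values of two linear forms at
   [u], [v], [w]. *)
Lemma singular_coef (x y z x' y' z' : F) : x * x' = 0 -> y * y' = 0 ->
  (x * y' + y * x') * ((x * z' + z * x') * (y * z' + z * y')
    - (x * y' + y * x') * (z * z')) = 0.
Proof.
by move=> /eqP + /eqP; rewrite !mulf_eq0 => /orP[]/eqP-> /orP[]/eqP->; ring.
Qed.

Lemma real_line_pair_through (a b c d : F) :
  real_line_pair (through_form (a, b, c, d)) =
  (a * (b * c - a * d) == 0) && ~~ [&& a == 0, b == 0 & c == 0].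
Proof.
apply/existsP/andP => [[l /existsP[m /andP[npr /eqP Q]]]|[/eqP D nz]].
  have Qx x : qval (through_form (a, b, c, d)) x = 1 * (lval l x * lval m x).
    by rewrite /qval Q mevalM !meval_linform mul1r.
  have := through_formK (a, b, c, d).
  rewrite /through_coef !(polar_prod Qx) !Qx !mul1r => -[<- <- <- <-].
  have/eqP := qval_through_col0 (a, b, c, d); rewrite Qx mul1r => /eqP uu.
  have/eqP := qval_through_col1 (a, b, c, d); rewrite Qx mul1r => /eqP vv.
  split; first exact/eqP/singular_coef.
  (* If a = b = c = 0, each sum l(p)m(p') + l(p')m(p) over two of the points u, v, w vanishes. As
     l(u)m(u) = l(v)m(v) = 0, both summands vanish too, so all minors are zero. *)
  apply: contra npr => /and3P[/eqP uv /eqP uw /eqP vw].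
  have [luv lvu] := cross_eq0 uu uv; have [luw lwu] := cross_eq0 uu uw.
  have [lvw lwv] := cross_eq0 vv vw.
  apply/(proportionalP _ _ uA) => i j.
  by elim/ord3_ind: i; elim/ord3_ind: j; rewrite // ?luv ?lvu ?luw ?lwu ?lvw.
have [a0|a0] := eqVneq a 0.
  (* With a = 0 the form is divisible by [ga]; proportionality of the cofactor to [ga] would force b
     = c = 0. *)
  exists (b *: al + c *: be + d *: ga); apply/existsP; exists ga.
  apply/andP; split.
    apply: contra nz => /(proportionalP _ _ uA) minor.
    have := minor 0 2; have := minor 1 2.
    rewrite !lvalDl !lvalZ !lval_dual /= ?(mulr0, mulr1, addr0, add0r).
    by move=> -> ->; rewrite a0 eqxx.
  rewrite -quadform_linprod; apply/eqP; congr quadform; apply: qval_inj => x.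
  by rewrite qval_through qval_linprod a0 !lvalDl !lvalZ; ring.
(* The product of these factors has [ga]^2 coefficient bc/a, which is d since bc = ad. Their minor
   at u, v is a, hence nonzero. *)
exists (a *: al + c *: ga); apply/existsP; exists (be + (b / a) *: ga).
apply/andP; split.
  apply: contra a0 => /(proportionalP _ _ uA)/(_ 0 1).
  rewrite !lvalDl !lvalZ !lval_dual /= ?(mulr0, mulr1, addr0, add0r).
  by move=> ->.
have {D}d_eq : d = b * c / a.
  move/eqP: D; rewrite mulf_eq0 (negPf a0) /= subr_eq0 => /eqP->.
  by field.
rewrite -quadform_linprod; apply/eqP; congr quadform; apply: qval_inj => x.
rewrite qval_through qval_linprod d_eq !lvalDl !lvalZ.
by field.
Qed.

End FormsThrough.

(** * Hyperplanes as coefficient vectors up to scalars *)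

Section Hyperplanes.
Variable F : finFieldType.
Implicit Types (a b : 'rV[F]_6).

Lemma in_hyperplane a y : (y \in hyperplane a) = ((y *m a^T) 0 0 == 0).
Proof.
by rewrite inE mxE; congr (_ == 0); apply: eq_bigr => i _; rewrite mxE mulrC.
Qed.

Lemma hyperplaneZ k a : k != 0 -> hyperplane (k *: a) = hyperplane a.
Proof.
move=> k0; apply/setP => y; rewrite !in_hyperplane linearZ -scalemxAr mxE.
by rewrite mulf_eq0 (negPf k0).
Qed.

Lemma hyperplane_inj a b : a != 0 -> b != 0 -> hyperplane a = hyperplane b ->
  exists2 k, k != 0 & b = k *: a.
Proof.
move=> a0 b0 ab.
have minor i j : b 0 j * a 0 i = b 0 i * a 0 j.
  (* This vector is orthogonal to a, so it also lies in the hyperplane of b, and a 2 x 2 minor of a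
     and b vanishes. *)
  have: a 0 i *: delta_mx 0 j - a 0 j *: delta_mx 0 i \in hyperplane b.
    rewrite -ab in_hyperplane mulmxBl -!scalemxAl -!rowE !mxE.
    by rewrite subr_eq0 mulrC.
  rewrite in_hyperplane mulmxBl -!scalemxAl -!rowE !mxE subr_eq0 => /eqP.
  by rewrite mulrC => ->; rewrite mulrC.
have [i ai] : exists i, a 0 i != 0.
  by apply/rV0Pn.
have Eb : b = (b 0 i / a 0 i) *: a.
  apply/rowP => j; rewrite !mxE; apply: (mulIf ai).
  by rewrite minor mulrAC divfK.
exists (b 0 i / a 0 i) => //.
by apply: contraNneq b0 => k0; rewrite Eb k0 scale0r.
Qed.

(** The fibres of [hyperplane] on S are the sets of nonzero multiples of one vector, each of size q
    - 1. *)
Lemma card_hyperplanes (S : {set 'rV[F]_6}) : 0 \notin S ->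
  (forall k a, k != 0 -> a \in S -> k *: a \in S) ->
  #|S| = (#|@hyperplane F @: S| * #|F|.-1)%N.
Proof.
have scalerI_l a : a != 0 -> injective (fun k : F => k *: a).
  by move=> /rV0Pn[i ai] k k' /rowP/(_ i); rewrite !mxE => /(mulIf ai).
move=> S0 SZ; rewrite -sum1_card (partition_big_imset (@hyperplane F)) /=.
rewrite -[RHS]sum_nat_const; apply: eq_bigr => _ /imsetP[a aS ->].
have a0 : a != 0 by apply: contraNneq S0 => <-.
rewrite -(cardC1 0) -(card_imset _ (scalerI_l _ a0)) sum1dep_card.
apply: eq_card => b; rewrite inE; apply/andP/imsetP => [[bS /eqP ba]|[k k0 ->]].
  have b0 : b != 0 by apply: contraNneq S0 => <-.
  by have [k k0 ->] := hyperplane_inj a0 b0 (esym ba); exists k.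
by rewrite SZ // hyperplaneZ.
Qed.

End Hyperplanes.

(** * Hyperplanes through a line of the orbit *)

Section Line.
Variables (F : finFieldType) (A : 'M[F]_3) (L : {set 'rV[F]_6}).
Hypothesis uA : A \in unitmx.
Hypothesis LA : [set sym_mx y | y in L] = [set A *m M *m A^T | M in diag_line F].

Lemma diag_mxE (x y : F) i j :
  (A *m diag_mx (\row_k [:: x; y; 0]`_k) *m A^T) i j
   = x * (A i 0 * A j 0) + y * (A i 1 * A j 1).
Proof. by rewrite mul_mx_diag !mxE sum_ord3 !mxE /=; ring. Qed.

(** A point of the line has matrix x u u^T + y v v^T, and pairing it with the form Q gives x Q(u) +
    y Q(v). *)
Lemma line_sub_hyperplane a : (L \subset hyperplane a)
  = (qval a (col 0 A) == 0) && (qval a (col 1 A) == 0).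
Proof.
have eval x y z : sym_mx z = A *m diag_mx (\row_k [:: x; y; 0]`_k) *m A^T ->
    (z \in hyperplane a) = (x * qval a (col 0 A) + y * qval a (col 1 A) == 0).
  move=> /matrixP zA; have zE i j : z 0 (symidx i j)
      = x * (A i 0 * A j 0) + y * (A i 1 * A j 1).
    by rewrite -diag_mxE -zA mxE.
  by rewrite inE sum_symidx !zE !qvalE !mxE; congr (_ == 0); ring.
apply/subsetP/andP => [sub|[/eqP au /eqP av] z zL].
  have ev x y : x * qval a (col 0 A) + y * qval a (col 1 A) == 0.
    have: A *m diag_mx (\row_k [:: x; y; 0]`_k) *m A^T \in [set sym_mx y | y in L].
      by rewrite LA; apply: imset_f; apply: imset2_f.
    by case/imsetP => z zL /esym/eval <-; apply: sub.
  by have := ev 1 0; have := ev 0 1; rewrite !mul0r !mul1r addr0 add0r.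
have: sym_mx z \in [set sym_mx y | y in L] by apply: imset_f.
rewrite LA => /imsetP[_ /imset2P[x y _ _ ->] /eval ->].
by rewrite au av !mulr0 addr0.
Qed.

(** This turns each entry of the distribution into a count of quadruples; the factor q - 1 stays on
    the right to avoid dividing in the naturals. *)
Lemma num_through_o5 (P : pred 'rV[F]_6) (T : {set F * F * F * F}) :
  (forall t, (through_form A t != 0) && P (through_form A t) = (t \in T)) ->
  (forall k a b c d, k != 0 -> (a, b, c, d) \in T ->
     (k * a, k * b, k * c, k * d) \in T) ->
  #|T| = (num_through L (hyperplanes_of P) * #|F|.-1)%N.
Proof.
move=> PT TZ; pose S := through_form A @: T.
have -> : num_through L (hyperplanes_of P) = #|@hyperplane F @: S|.
  congr #|pred_of_set _|; apply/setP => H.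
  apply/setIdP/imsetP => [[]|[_ /imsetP[t tT ->] ->]].
    case/imsetP => a; rewrite inE => /andP[a0 Pa] ->.
    rewrite line_sub_hyperplane => /andP[/eqP au /eqP av]; exists a => //.
    rewrite -(through_formP uA au av) imset_f // -PT (through_formP uA au av).
    by rewrite a0 Pa.
  split; last first.
    rewrite line_sub_hyperplane (qval_through_col0 uA) (qval_through_col1 uA).
    by rewrite !eqxx.
  by apply: imset_f; rewrite inE PT.
rewrite -card_hyperplanes ?card_imset //.
- exact: can_inj (through_formK uA).
- by apply/imsetP => -[t]; rewrite -PT => /andP[/eqP t0 _] /esym.
move=> k _ k0 /imsetP[[[[a b] c] d] tT ->]; apply/imsetP.
exists (k * a, k * b, k * c, k * d); first exact: TZ.
by rewrite /through_form !scalerDr !scalerA.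
Qed.

End Line.

(** * Counting the coefficient quadruples *)

Section Counting.
Variable F : finFieldType.

Definition double_coefs : {set F * F * F * F} :=
  [set t | let: (a, b, c, d) := t in [&& a == 0, b == 0, c == 0 & d != 0]].

Definition real_pair_coefs : {set F * F * F * F} :=
  [set t | let: (a, b, c, d) := t in
     (a * (b * c - a * d) == 0) && ~~ [&& a == 0, b == 0 & c == 0]].

Definition nonsingular_coefs : {set F * F * F * F} :=
  [set t | let: (a, b, c, d) := t in a * (b * c - a * d) != 0].

Lemma card_double_coefs : #|double_coefs| = #|F|.-1.
Proof.
have inj : injective (fun d : F => ((0 : F), (0 : F), (0 : F), d)).
  by move=> d d' [].
rewrite -(cardC1 (0 : F)) -(card_imset _ inj).
apply: eq_card => -[[[a b] c] d]; rewrite inE.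
apply/and4P/imsetP => [[/eqP-> /eqP-> /eqP-> d0]|[e e0 [-> -> -> ->]]].
  by exists d.
by rewrite !eqxx.
Qed.

(** For a nonzero, d can be traded for e = bc - ad, with inverse d = (bc - e)/a. Then a and e range
    over nonzero scalars, while b and c are free. *)
Lemma card_nonsingular_coefs :
  #|nonsingular_coefs| = (#|F|.-1 ^ 2 * #|F| ^ 2)%N.
Proof.
pose f (t : F * F * F * F) := let: (a, b, c, d) := t in
  (a, b, c, (b * c - d) / a).
pose D := setX (setX (setX [set~ (0 : F)] [set: F]) [set: F]) [set~ (0 : F)].
have inj : {in D &, injective f}.
  move=> [[[a b] c] d] [[[a' b'] c'] d']; rewrite !inE => /andP[+ _] _ [<- <- <-].
  by rewrite !andbT => a0 /(divIf a0)/(addrI _)/oppr_inj->.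
transitivity #|f @: D|; last first.
  by rewrite card_in_imset // !cardsX !cardsC1 cardsT; ring.
apply: eq_card => -[[[a b] c] d]; rewrite inE mulf_eq0 negb_or.
apply/andP/imsetP => [[a0 e0]|[[[[a' b'] c'] e] + [-> -> -> ->]]].
  exists (a, b, c, b * c - a * d); first by rewrite !inE a0.
  by rewrite /f subKr mulrC mulKf.
rewrite !inE /= !andbT => /andP[a0 e0]; split=> //.
by rewrite [a' * _]mulrC divfK // subKr.
Qed.

(** The q^4 quadruples split into these, the nonsingular ones, and the q quadruples [Z] with a = b =
    c = 0, which include the zero form. So the count is q^4 - q - (q - 1)^2 q^2. *)
Lemma card_real_pair_coefs :
  #|real_pair_coefs| = (#|F|.-1 * (2 * #|F| ^ 2 + #|F|))%N.
Proof.
pose Z := setX (setX (setX [set (0 : F)] [set (0 : F)]) [set (0 : F)]) [set: F].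
have : (#|real_pair_coefs| + #|Z| + #|nonsingular_coefs| = #|F| ^ 4)%N.
  have <- : #|real_pair_coefs :|: Z :|: nonsingular_coefs| = (#|F| ^ 4)%N.
    rewrite (_ : _ :|: _ = setT) ?cardsT ?card_prod; first by ring.
    apply/setP => -[[[a b] c] d]; rewrite !inE.
    by case: (_ * _ == 0) => //=; case: (a == 0); case: (b == 0); case: (c == 0).
  rewrite !cardsU !disjoint_setI0 ?cards0 ?subn0 //.
    rewrite -setI_eq0; apply/eqP/setP => -[[[a b] c] d]; rewrite !inE.
    case: (a =P 0) => [->|_]; rewrite ?mul0r ?eqxx ?andbF //=.
    by case: (_ * _ == 0).
  rewrite -setI_eq0; apply/eqP/setP => -[[[a b] c] d]; rewrite !inE andbT.
  by case: (a == 0); case: (b == 0); case: (c == 0); rewrite ?andbF.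
rewrite card_nonsingular_coefs !cardsX !cards1 cardsT.
have : (0 < #|F|)%N by apply/card_gt0P; exists 0.
case: #|F| => // n _ /=; nia.
Qed.

End Counting.

Theorem lemma4p2 (q : nat) (F E : finFieldType) (iota : {rmorphism F -> E})
    (cardF : #|F| = q) (cardE : #|E| = (q ^ 2)%N)
    (L : {set 'rV[F]_6}) (LO5 : in_o5 L) :
  OD4 iota L = [:: 1; 2 * q ^ 2 + q; 0; q ^ 3 - q ^ 2]%N.
Proof.
case: LO5 => A uA LA; have q1 : (0 < q.-1)%N.
  by rewrite -cardF -subn1 subn_gt0 finNzRing_gt1.
have form0 t : (through_form A t == 0) = (t == (0, 0, 0, 0)).
  have t0 : through_form A (0, 0, 0, 0) = 0 by rewrite /through_form !scale0r !addr0.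
  by rewrite -(inj_eq (can_inj (through_formK uA))) t0.
have scale_neq0 (k x : F) : k != 0 -> (k * x == 0) = (x == 0).
  by move=> k0; rewrite mulf_eq0 (negPf k0).
have scale_disc (k a b c d : F) : k != 0 ->
    (k * a * (k * b * (k * c) - k * a * (k * d)) == 0)
    = (a * (b * c - a * d) == 0).
  (* The discriminant is homogeneous of degree 3 in the coefficients. *)
  move=> k0; rewrite -[RHS](mulrI_eq0 _ (mulfI (expf_neq0 3 k0))).
  by congr (_ == 0); ring.
have count := num_through_o5 uA LA.
(* Each entry is compared after multiplication by q - 1, which is positive. *)
rewrite /OD4; congr [:: _; _; _; _]; apply/eqP; rewrite -(eqn_pmul2r q1) -{1}cardF.
- rewrite -(count _ (double_coefs F)) ?card_double_coefs ?cardF ?mul1n //.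
    move=> [[[a b] c] d]; rewrite double_line_through // form0 !xpair_eqE inE.
    by case: (a == 0); case: (b == 0); case: (c == 0); rewrite ?andbF ?andbT.
  by move=> k a b c d k0; rewrite !inE !(scale_neq0 _ _ k0).
- rewrite -(count _ (real_pair_coefs F)) ?card_real_pair_coefs ?cardF 1?mulnC //.
    move=> [[[a b] c] d]; rewrite real_line_pair_through // form0 !xpair_eqE inE.
    by case: (a == 0); case: (b == 0); case: (c == 0); rewrite ?andbF ?andbT //=.
  by move=> k a b c d k0; rewrite !inE scale_disc // !(scale_neq0 _ _ k0).
- rewrite -(count (imaginary_line_pair iota) set0) ?cards0 //.
    move=> t; rewrite inE; have [//|t0] := eqVneq (through_form A t) 0.
    rewrite (imaginary_line_pairF _ uA) ?(qval_through_col0 uA) //.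
    exact: qval_through_col1.
  by move=> k a b c d _; rewrite inE.
rewrite -(count _ (nonsingular_coefs F)) ?card_nonsingular_coefs ?cardF //.
(* Writing q as a successor resolves the truncated subtractions in q - 1 and q^3 - q^2. *)
- by apply/eqP; case: q q1 {cardF cardE} => // n _; rewrite /=; nia.
- move=> [[[a b] c] d]; rewrite nonsingular_through // form0 !xpair_eqE inE.
  by case: (a =P 0) => [->|_]; rewrite ?mul0r ?eqxx ?andbF.
by move=> k a b c d k0; rewrite !inE scale_disc.
Qed.
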